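(* Let $A_1A_2A_3A_4$ be a quadrilateral inscribed in a nondegenerate conic $\mathcal{C}$, and let the points $N_1,N_2,P_1,P_2,Z_1,Z_2,Z_3,Z_4$ be as defined in the context. Then the points $N_1$, $N_2$, $P_1$, $P_2$, $Z_1$, $Z_2$, $Z_3$ and $Z_4$ lie on the same conic.
   Context: The ambient plane is the complex projective plane (real configurations being included), and $A_1,A_2,A_3,A_4$ are four distinct points of the nondegenerate conic $\mathcal{C}$. A conic is the zero locus of a nonzero homogeneous quadratic form. For distinct points $P,Q$, $l(PQ)$ denotes the line through them. Let $t_i$ be the tangent line to $\mathcal{C}$ at $A_i$. Let $M_1=l(A_1A_2)\cap l(A_3A_4)$ and $M_2=l(A_2A_3)\cap l(A_4A_1)$. Let $N_1=t_1\cap t_2$, $P_1=t_3\cap t_4$, $N_2=t_1\cap t_4$, $P_2=t_2\cap t_3$. Let $U_1,U_2$ be the two points where the tangent lines from $M_1$ touch $\mathcal{C}$, and $V_1,V_2$ the two points where the tangent lines from $M_2$ touch $\mathcal{C}$. Let $Z_1=l(M_1U_1)\cap l(M_2V_1)$, $Z_2=l(M_1U_1)\cap l(M_2V_2)$, $Z_3=l(M_1U_2)\cap l(M_2V_2)$, $Z_4=l(M_1U_2)\cap l(M_2V_1)$. *)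

(* Defs.v *)
From HB Require Import structures.
From mathcomp Require Import all_boot all_order all_algebra.
From mathcomp Require Import complex.
From mathcomp Require Import reals.

Set Implicit Arguments.
Unset Strict Implicit.
Unset Printing Implicit Defensive.

Import GRing.Theory.
Local Open Scope ring_scope.

(* The complex projective plane is the projectivization of the row space C^3,
   with C = R[i].  Points are its subspaces of dimension 1 and lines its
   subspaces of dimension 2, so that incidence is inclusion and equality of
   points is Leibniz equality. *)
Record point (R : realType) := Point {
  point_space :> {vspace 'rV[R[i]]_3};
  _ : \dim point_space == 1%N
}.

HB.instance Definition _ (R : realType) := [isSub for @point_space R].
HB.instance Definition _ (R : realType) := [Choice of point R by <:].

Definition coords (R : realType) (P : point R) : 'rV[R[i]]_3 := vpick P.

Lemma point_coords (R : realType) (P : point R) :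
  coords P != 0 /\ P = <[coords P]>%VS :> {vspace _}.
Proof.
have dP : \dim P = 1%N by apply/eqP; case: P.
have nz : coords P != 0 by rewrite vpick0 -dimv_eq0 dP.
split=> //; apply/eqP.
by rewrite eq_sym eqEdim dim_vline nz dP -memvE memv_pick.
Qed.

(* This is a line only when P <> Q. *)
Definition line_through (R : realType) (P Q : point R) :
  {vspace 'rV[R[i]]_3} := (P + Q)%VS.

Definition meet_at (R : realType) (l m : {vspace 'rV[R[i]]_3}) (P : point R) :
  Prop := (l :&: m)%VS = P.

(* A quadratic form over C is given by its symmetric matrix S, as
   x |-> x S x^T; the form is nonzero if and only if S is. *)
Record conic (R : realType) := Conic {
  gram : 'M[R[i]]_3;
  _ : gram^T = gram;
  _ : gram != 0
}.

Definition qform (R : realType) (C : conic R) (x : 'rV[R[i]]_3) : R[i] :=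
  (x *m gram C *m x^T) 0 0.

Definition on_conic (R : realType) (C : conic R) (P : point R) : Prop :=
  forall x, x \in (P : {vspace _}) -> qform C x = 0.

Definition nondegenerate_conic (R : realType) (C : conic R) : Prop :=
  gram C \in unitmx.

(* The column of the partial derivatives of [qform C] at x. *)
Definition gradient (R : realType) (C : conic R) (x : 'rV[R[i]]_3) :
  'cV[R[i]]_3 := (gram C *m x^T) *+ 2.

Lemma qform_expansion (R : realType) (C : conic R) (x y : 'rV[R[i]]_3)
    (t : R[i]) :
  qform C (x + t *: y)
    = qform C x + t * (y *m gradient C x) 0 0 + t ^+ 2 * qform C y.
Proof.
have sym : x *m gram C *m y^T = y *m gram C *m x^T.
  rewrite [LHS]mx11_scalar -tr_scalar_mx -mx11_scalar !trmx_mul trmxK mulmxA.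
  by case: C => S /= ->.
rewrite /qform /gradient mulr2n linearD linearZ /= !mulmxDl !mulmxDr.
rewrite -!scalemxAl -!scalemxAr scalerA sym !mulmxA.
move: (x *m gram C *m x^T) (y *m gram C *m x^T) (y *m gram C *m y^T).
move=> a b c; by rewrite !mxE expr2 mulrDr !addrA.
Qed.

(* The tangent line at a point A of the conic: the points x with
   sum_j x_j (d_j q)(A) = 0.  It does not depend on the choice of
   coordinates of A, the gradient being homogeneous. *)
Definition tangent (R : realType) (C : conic R) (A : point R) :
  {vspace 'rV[R[i]]_3} := lker (linfun (mulmxr (gradient C (coords A)))).

Lemma mem_tangent (R : realType) (C : conic R) (A : point R) x :
  (x \in tangent C A) = (x *m gradient C (coords A) == 0).
Proof. by rewrite memv_ker lfunE. Qed.

(* The tangent line to C at its point U passes through M. *)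
Definition touches_from (R : realType) (C : conic R) (M U : point R) : Prop :=
  on_conic C U /\ (M <= tangent C U)%VS.

(* Main.v *)
(* Let b be the polar form of C.  Vectors a1, ..., a4 representing the A_i can
   be scaled so that a4 = a1 - a2 + a3.  Then e1 = a1 + a3, e2 = a2 - a3 and
   e3 = a1 - a2 represent the diagonal points of the quadrangle, with M1 = <e3>
   and M2 = <e2>, and are pairwise orthogonal for b.  The required conic is
   b(x,e1)^2 = b(x,e2)^2 + b(x,e3)^2. *)
Require Import Defs.
From HB Require Import structures.
From mathcomp Require Import all_boot all_order all_algebra.
From mathcomp Require Import complex.
From mathcomp Require Import reals.
From mathcomp Require Import ring.

Set Implicit Arguments.
Unset Strict Implicit.
Unset Printing Implicit Defensive.

Import GRing.Theory Num.Theory.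
Local Open Scope ring_scope.

(** * Bilinear forms given by a matrix *)

(** With [S = gram C] this is the polar form b of the conic: [qform C x] unfolds to
    [bform (gram C) x x]. *)
Definition bform (F : fieldType) (n : nat) (S : 'M[F]_n) (x y : 'rV[F]_n) : F :=
  (x *m S *m y^T) 0 0.

Lemma bformDl (F : fieldType) (n : nat) (S : 'M[F]_n) x y z :
  bform S (x + y) z = bform S x z + bform S y z.
Proof. by rewrite /bform !mulmxDl mxE. Qed.

Lemma bformZl (F : fieldType) (n : nat) (S : 'M[F]_n) k x z :
  bform S (k *: x) z = k * bform S x z.
Proof. by rewrite /bform -!scalemxAl mxE. Qed.

Lemma bformDr (F : fieldType) (n : nat) (S : 'M[F]_n) x y z :
  bform S z (x + y) = bform S z x + bform S z y.
Proof. by rewrite /bform linearD mulmxDr mxE. Qed.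

Lemma bformZr (F : fieldType) (n : nat) (S : 'M[F]_n) k x z :
  bform S z (k *: x) = k * bform S z x.
Proof. by rewrite /bform linearZ -scalemxAr mxE. Qed.

Lemma bformNl (F : fieldType) (n : nat) (S : 'M[F]_n) x z :
  bform S (- x) z = - bform S x z.
Proof. by rewrite /bform !mulNmx mxE. Qed.

Lemma bformNr (F : fieldType) (n : nat) (S : 'M[F]_n) x z :
  bform S z (- x) = - bform S z x.
Proof. by rewrite /bform linearN mulmxN mxE. Qed.

Definition bformE := (bformDl, bformDr, bformNl, bformNr, bformZl, bformZr).

Lemma bformC (F : fieldType) (n : nat) (S : 'M[F]_n) x y :
  S^T = S -> bform S x y = bform S y x.
Proof.
move=> symS; rewrite /bform.
rewrite [in LHS](mx11_scalar (x *m S *m y^T)) -tr_scalar_mx -mx11_scalar.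
by rewrite !trmx_mul trmxK symS mulmxA.
Qed.

(** * Linear independence and isotropic vectors *)

Lemma row_free_col_mx (F : fieldType) (n : nat) (x y : 'rV[F]_n) :
  x != 0 -> (forall k, y != k *: x) -> row_free (col_mx x y).
Proof.
move=> x0 nxy; apply: inj_row_free => v.
rewrite -[v]hsubmxK mul_row_col.
set s := lsubmx v; set t := rsubmx v.
rewrite (mx11_scalar s) (mx11_scalar t) !mul_scalar_mx.
case: (eqVneq (t 0 0) 0) => [-> | t0].
  rewrite scale0r addr0 => /eqP; rewrite scaler_eq0 (negbTE x0) orbF => /eqP ->.
  by rewrite raddf0 row_mx0.
move=> /eqP; rewrite addr_eq0 => /eqP eq_st.
have /negP[] := nxy (- (s 0 0 / t 0 0)); apply/eqP.
by rewrite scaleNr mulrC -scalerA eq_st scalerN opprK scalerA mulVf ?scale1r.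
Qed.

(* A totally isotropic subspace of a nondegenerate form in dimension 3 has
   dimension at most 1. *)
Lemma bform_isotropic_neq0 (F : fieldType) (S : 'M[F]_3) x y :
  S^T = S -> S \in unitmx -> x != 0 -> (forall k, y != k *: x) ->
  bform S x x = 0 -> bform S y y = 0 -> bform S x y != 0.
Proof.
move=> symS uS x0 nxy xx yy; apply/eqP => xy.
have yx : bform S y x = 0 by rewrite bformC.
have b0 u v : bform S u v = 0 -> u *m S *m v^T = 0.
  by move=> uv; rewrite [LHS]mx11_scalar -/(bform S u v) uv raddf0.
have fA := row_free_col_mx x0 nxy.
have : col_mx x y *m S *m (col_mx x y)^T = 0.
  by rewrite tr_col_mx mul_col_mx mul_mx_row !mul_col_mx !b0 // col_mx0 row_mx0.
(* A product that vanishes through a space of dimension 3 bounds the sum of the two ranks by 3, but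
   both factors have rank 2. *)
move=> /mulmx0_rank_max.
by rewrite mxrank_tr mxrankMfree ?row_free_unit // (eqP fA).
Qed.

(** * The quadratic form of the required conic *)

(** Each [e^T *m e] is the matrix of the square of a linear form; multiplying by [S] on both sides
    turns that linear form into b(x,e). *)
Definition diag_form (F : fieldType) (S : 'M[F]_3) (a1 a2 a3 : 'rV[F]_3) :
    'M[F]_3 :=
  S *m ((a1 + a3)^T *m (a1 + a3) - (a1 - a2)^T *m (a1 - a2)
        - (a2 - a3)^T *m (a2 - a3)) *m S.

Lemma diag_form_sym (F : fieldType) (S : 'M[F]_3) a1 a2 a3 :
  S^T = S -> (diag_form S a1 a2 a3)^T = diag_form S a1 a2 a3.
Proof.
move=> symS; rewrite /diag_form !trmx_mul symS mulmxA.
congr (_ *m _ *m _).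
have tr_sq (e : 'rV[F]_3) : (e^T *m e)^T = e^T *m e by rewrite trmx_mul trmxK.
by rewrite linearB linearB /= !tr_sq.
Qed.

Lemma bform_diag_form (F : fieldType) (S : 'M[F]_3) a1 a2 a3 x :
  S^T = S ->
  bform (diag_form S a1 a2 a3) x x =
  bform S x (a1 + a3) ^+ 2 - bform S x (a1 - a2) ^+ 2
    - bform S x (a2 - a3) ^+ 2.
Proof.
move=> symS.
(* The matrix factors into the 1 by 1 blocks of b(x,e) and b(e,x), which agree by symmetry. *)
have sq e : (x *m (S *m (e^T *m e) *m S) *m x^T) 0 0 = bform S x e ^+ 2.
  rewrite expr2 [in X in _ * X]bformC // /bform !mulmxA.
  by rewrite -[_ *m e *m _ *m _]mulmxA -[_ *m e *m _]mulmxA mxE big_ord1 !mulmxA.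
rewrite -!sq /bform /diag_form !(mulmxDl, mulmxDr, mulmxN, mulNmx).
by rewrite !mxE.
Qed.

(** The vector u is orthogonal to both m and itself, so only the m-component s of z counts: b(z,z) =
    s^2 b(m,m) and b(z,m) = s b(m,m). The conclusion is the classical equation of the pair of
    tangents from m. *)
Lemma bform_tangent_line (F : fieldType) (n : nat) (S : 'M[F]_n) m u s t :
  S^T = S -> bform S u u = 0 -> bform S m u = 0 ->
  let z := s *: m + t *: u in
  bform S z z * bform S m m = bform S z m ^+ 2.
Proof.
move=> symS uu mu /=; rewrite !bformE (bformC u m) // uu mu.
ring.
Qed.

(** * Isotropic triples and quadruples *)

(** The Gram matrix of the triple has zero diagonal and off-diagonal entries r, q, p, hence
    determinant 2pqr, which is nonzero. Each coefficient is isolated by a combination of the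
    pairings with the three vectors. *)
Lemma isotropic_triple_free (F : fieldType) (n : nat) (S : 'M[F]_n)
    a1 a2 a3 x y z :
  S^T = S -> 2 != 0 :> F ->
  bform S a1 a1 = 0 -> bform S a2 a2 = 0 -> bform S a3 a3 = 0 ->
  bform S a1 a2 != 0 -> bform S a1 a3 != 0 -> bform S a2 a3 != 0 ->
  x *: a1 + y *: a2 + z *: a3 = 0 -> [/\ x = 0, y = 0 & z = 0].
Proof.
move=> symS nz2 e11 e22 e33 n12 n13 n23 eq0.
have pair v : bform S (x *: a1 + y *: a2 + z *: a3) v = 0.
  by rewrite eq0 /bform !mul0mx mxE.
have := pair a3; have := pair a2; have := pair a1.
rewrite !bformE e11 e22 e33 (bformC a2 a1) // (bformC a3 a1) // (bformC a3 a2) //.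
set r := bform S a1 a2 in n12 *; set q := bform S a1 a3 in n13 *.
set p := bform S a2 a3 in n23 *; rewrite !mulr0 add0r !addr0 => E1 E2 E3.
split; apply/eqP.
- have : x * (2 * q * r) = 0.
    transitivity (r * (x * q + y * p) + q * (x * r + z * p)
                  - p * (y * r + z * q)); first by ring.
    by rewrite E1 E2 E3; ring.
  by move/eqP; rewrite !mulf_eq0 (negbTE nz2) (negbTE n12) (negbTE n13) !orbF.
- have : y * (2 * p * r) = 0.
    transitivity (r * (x * q + y * p) - q * (x * r + z * p)
                  + p * (y * r + z * q)); first by ring.
    by rewrite E1 E2 E3; ring.
  by move/eqP; rewrite !mulf_eq0 (negbTE nz2) (negbTE n12) (negbTE n23) !orbF.
- have : z * (2 * p * q) = 0.
    transitivity (- r * (x * q + y * p) + q * (x * r + z * p)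
                  + p * (y * r + z * q)); first by ring.
    by rewrite E1 E2 E3; ring.
  by move/eqP; rewrite !mulf_eq0 (negbTE nz2) (negbTE n13) (negbTE n23) !orbF.
Qed.

Lemma free_triple_span (F : fieldType) (a1 a2 a3 v : 'rV[F]_3) :
  (forall x y z, x *: a1 + y *: a2 + z *: a3 = 0 -> [/\ x = 0, y = 0 & z = 0]) ->
  exists x y z, v = x *: a1 + y *: a2 + z *: a3.
Proof.
move=> free_a.
(* The size is written [1 + (1 + 1)] so that block products apply while B remains square. *)
pose B : 'M[F]_(1 + (1 + 1), 3) := col_mx a1 (col_mx a2 a3).
have mulB (w1 w2 w3 : 'M[F]_1) :
    row_mx w1 (row_mx w2 w3) *m B
    = w1 0 0 *: a1 + w2 0 0 *: a2 + w3 0 0 *: a3.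
  rewrite !mul_row_col (mx11_scalar w1) (mx11_scalar w2) (mx11_scalar w3).
  by rewrite !mul_scalar_mx addrA !mxE.
have fB : row_free B.
  apply: inj_row_free => w; rewrite -[w]hsubmxK -[rsubmx w]hsubmxK mulB.
  case/free_a => h1 h2 h3.
  rewrite (mx11_scalar (lsubmx w)) h1 (mx11_scalar (lsubmx (rsubmx w))) h2.
  by rewrite (mx11_scalar (rsubmx (rsubmx w))) h3 raddf0 !row_mx0.
have /row_fullP[B' B'B] : row_full B by rewrite /row_full (eqP fB).
have: v = v *m B' *m B by rewrite -mulmxA B'B mulmx1.
rewrite -[v *m B']hsubmxK -[rsubmx (v *m B')]hsubmxK mulB => ->.
by do 3 eexists.
Qed.

(** If one coefficient vanished, isotropy of b4 would make a second one vanish; b4 would then be a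
    multiple of some b_i and orthogonal to it. The minus sign prepares the normalization a4 = a1 -
    a2 + a3. *)
Lemma isotropic_quadruple_relation (F : fieldType) (S : 'M[F]_3) b1 b2 b3 b4 :
  S^T = S -> 2 != 0 :> F ->
  bform S b1 b1 = 0 -> bform S b2 b2 = 0 -> bform S b3 b3 = 0 ->
  bform S b4 b4 = 0 ->
  bform S b1 b2 != 0 -> bform S b1 b3 != 0 -> bform S b2 b3 != 0 ->
  bform S b1 b4 != 0 -> bform S b2 b4 != 0 -> bform S b3 b4 != 0 ->
  exists c1 c2 c3, [/\ c1 != 0, c2 != 0, c3 != 0 &
    b4 = c1 *: b1 - c2 *: b2 + c3 *: b3].
Proof.
move=> symS nz2 e11 e22 e33 e44 n12 n13 n23 n14 n24 n34.
have [x [y [z eq4]]] : exists x y z, b4 = x *: b1 + y *: b2 + z *: b3.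
  by apply: free_triple_span => x y z; apply: (isotropic_triple_free symS).
move: e44 n14 n24 n34; rewrite eq4 !bformE e11 e22 e33.
rewrite (bformC b2 b1) // (bformC b3 b1) // (bformC b3 b2) //.
set r := bform S b1 b2 in n12 *; set q := bform S b1 b3 in n13 *.
set p := bform S b2 b3 in n23 * => e44 n14 n24 n34.
have E : x * y * r + x * z * q + y * z * p = 0.
  have : 2 * (x * y * r + x * z * q + y * z * p) = 0 by rewrite -e44; ring.
  by move/eqP; rewrite mulf_eq0 (negbTE nz2) => /eqP.
exists x, (- y), z; split; last by rewrite scaleNr opprK.
- apply/eqP => x0; rewrite x0 in E n24 n34.
  have /eqP : y * z * p = 0 by rewrite -E; ring.
  rewrite !mulf_eq0 (negbTE n23) orbF => /orP[] /eqP h; rewrite h in n24 n34.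
  + by case/eqP: n34; ring.
  + by case/eqP: n24; ring.
- rewrite oppr_eq0; apply/eqP => x0; rewrite x0 in E n14 n34.
  have /eqP : x * z * q = 0 by rewrite -E; ring.
  rewrite !mulf_eq0 (negbTE n13) orbF => /orP[] /eqP h; rewrite h in n14 n34.
  + by case/eqP: n34; ring.
  + by case/eqP: n14; ring.
- apply/eqP => x0; rewrite x0 in E n14 n24.
  have /eqP : x * y * r = 0 by rewrite -E; ring.
  rewrite !mulf_eq0 (negbTE n12) orbF => /orP[] /eqP h; rewrite h in n14 n24.
  + by case/eqP: n24; ring.
  + by case/eqP: n14; ring.
Qed.

(** This is half of the isotropy of a4 = a1 - a2 + a3. The same equation expresses that e1, e2 and
    e3 are pairwise orthogonal. *)
Lemma bform_quadrangle (F : fieldType) (n : nat) (S : 'M[F]_n) a1 a2 a3 :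
  S^T = S -> 2 != 0 :> F ->
  bform S a1 a1 = 0 -> bform S a2 a2 = 0 -> bform S a3 a3 = 0 ->
  bform S (a1 - a2 + a3) (a1 - a2 + a3) = 0 ->
  bform S a1 a3 = bform S a1 a2 + bform S a2 a3.
Proof.
move=> symS nz2 e11 e22 e33; rewrite !bformE e11 e22 e33.
rewrite (bformC a2 a1) // (bformC a3 a1) // (bformC a3 a2) // => e44.
(* The difference of the two sides is doubled in order to match the expansion of b(a4,a4). *)
apply/eqP; rewrite -subr_eq0 -[_ == 0]orFb -(negbTE nz2) -mulf_eq0 -e44.
by apply/eqP; ring.
Qed.

(** * Nonvanishing of the form, and its zeros on tangents *)

(** At e1 the terms in e2 and e3 vanish by orthogonality, and the value is b(e1,e1)^2 = (2
    b(a1,a3))^2. *)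
Lemma diag_form_neq0 (F : fieldType) (S : 'M[F]_3) a1 a2 a3 :
  S^T = S -> 2 != 0 :> F ->
  bform S a1 a1 = 0 -> bform S a2 a2 = 0 -> bform S a3 a3 = 0 ->
  bform S (a1 - a2 + a3) (a1 - a2 + a3) = 0 ->
  bform S a1 a3 != 0 -> diag_form S a1 a2 a3 != 0.
Proof.
move=> symS nz2 e11 e22 e33 e44 n13; apply/eqP => D0.
have : bform (diag_form S a1 a2 a3) (a1 + a3) (a1 + a3) = 0.
  by rewrite D0 /bform mulmx0 mul0mx mxE.
have q_rp := bform_quadrangle symS nz2 e11 e22 e33 e44.
rewrite bform_diag_form // !bformE e11 e33 (bformC a3 a1) // (bformC a3 a2) //.
have /eqP nz : (2 * bform S a1 a3) ^+ 2 != 0 by rewrite expf_neq0 ?mulf_neq0.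
by move=> E; apply: nz; rewrite -E q_rp; ring.
Qed.

(* On the tangents from a point m one has b(z,z) b(m,m) = b(z,m)^2; expanding
   b(z,z) along the orthogonal basis of diagonal points then fixes
   b(z, a1 + a3)^2. *)
Lemma diag_form_tangent_meet (F : fieldType) (S : 'M[F]_3) a1 a2 a3 z :
  S^T = S -> 2 != 0 :> F ->
  bform S a1 a1 = 0 -> bform S a2 a2 = 0 -> bform S a3 a3 = 0 ->
  bform S (a1 - a2 + a3) (a1 - a2 + a3) = 0 ->
  bform S a1 a2 != 0 -> bform S a1 a3 != 0 -> bform S a2 a3 != 0 ->
  bform S z z * bform S (a1 - a2) (a1 - a2) = bform S z (a1 - a2) ^+ 2 ->
  bform S z z * bform S (a2 - a3) (a2 - a3) = bform S z (a2 - a3) ^+ 2 ->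
  bform (diag_form S a1 a2 a3) z z = 0.
Proof.
move=> symS nz2 e11 e22 e33 e44 n12 n13 n23.
move=> tangent12 tangent23; rewrite bform_diag_form //.
have [x [y [t eq_z]]] : exists x y t, z = x *: a1 + y *: a2 + t *: a3.
  by apply: free_triple_span => x y t; apply: (isotropic_triple_free symS).
have nz_coef : bform S (a1 - a2) (a1 - a2) * bform S (a2 - a3) (a2 - a3) != 0.
  rewrite !bformE e11 e22 e33 (bformC a2 a1) // (bformC a3 a2) //.
  have nz4 : (2 * bform S a1 a2) * (2 * bform S a2 a3) != 0 by rewrite !mulf_neq0.
  by apply: contraNneq nz4 => <-; apply/eqP; ring.
apply/eqP; rewrite -(mulIr_eq0 _ (mulIf nz_coef)); apply/eqP.
(* This clears denominators in b(z,z) = sum_i b(z,e_i)^2 / b(e_i,e_i), using b(e1,e1) = - b(e2,e2) -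
   b(e3,e3). Both brackets vanish by the tangency equations. *)
transitivity
  ((bform S z (a2 - a3) ^+ 2 - bform S z z * bform S (a2 - a3) (a2 - a3))
     * bform S (a1 - a2) (a1 - a2) ^+ 2
   + (bform S z (a1 - a2) ^+ 2 - bform S z z * bform S (a1 - a2) (a1 - a2))
     * bform S (a2 - a3) (a2 - a3) ^+ 2); last first.
  by rewrite tangent12 tangent23; ring.
rewrite eq_z; move: (bform_quadrangle symS nz2 e11 e22 e33 e44).
rewrite !bformE e11 e22 e33.
rewrite (bformC a2 a1) // (bformC a3 a1) // (bformC a3 a2) //.
move: (bform S a1 a2) (bform S a1 a3) (bform S a2 a3) => r q p.
by move=> ->; ring.
Qed.

(** * From points and lines to representative vectors *)

Lemma neq_lineP (F : fieldType) (V : vectType F) (u v : V) :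
  u != 0 -> <[u]>%VS != <[v]>%VS -> forall k, u != k *: v.
Proof.
move=> u0 nuv k; apply: contraNneq nuv => uv.
rewrite eqEdim !dim_vline u0 leq_b1 andbT.
by rewrite -memvE uv memvZ ?memv_line.
Qed.

Lemma vline_scale (F : fieldType) (V : vectType F) (k : F) (v : V) :
  k != 0 -> <[k *: v]>%VS = <[v]>%VS.
Proof.
move=> k0; apply/eqP; rewrite eqEsubv -!memvE memvZ ?memv_line //=.
by apply/vlineP; exists k^-1; rewrite scalerA mulVf ?scale1r.
Qed.

(** The tangent at A is the polar line of A: the factor 2 of the gradient cancels in characteristic
    zero, and a is a multiple of [coords A]. *)
Lemma mem_tangent_bform (R : realType) (C : conic R) (A : point R) a x :
  A = <[a]>%VS :> {vspace _} -> x \in tangent C A -> bform (gram C) x a = 0.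
Proof.
have [_ ->] := point_coords A => eqA.
rewrite mem_tangent /gradient => /eqP tan.
have /vlineP[k ->] : a \in <[coords A]>%VS by rewrite eqA memv_line.
have /eqP : (x *m (gram C *m (coords A)^T *+ 2)) 0 0 = 0 by rewrite tan mxE.
rewrite mulr2n mulmxDr mxE mulmxA -mulr2n mulrn_eq0 /= => /eqP E.
by rewrite bformZr /bform E mulr0.
Qed.

Lemma mem_line_through (R : realType) (P Q : point R) p q x :
  P = <[p]>%VS :> {vspace _} -> Q = <[q]>%VS :> {vspace _} ->
  x \in line_through P Q -> exists s t, x = s *: p + t *: q.
Proof.
rewrite /line_through => -> -> /memv_addP[_ /vlineP[s ->] [_ /vlineP[t ->] ->]].
by exists s, t.
Qed.

Lemma meet_atW (R : realType) (l m : {vspace 'rV[R[i]]_3}) (P : point R) x :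
  meet_at l m P -> x \in (P : {vspace _}) -> x \in l /\ x \in m.
Proof. by move=> <-; rewrite memv_cap => /andP. Qed.

Lemma gram_sym (R : realType) (C : conic R) : (gram C)^T = gram C.
Proof. by case: C. Qed.

Lemma point_vline_neq0 (R : realType) (A : point R) a :
  A = <[a]>%VS :> {vspace _} -> a != 0.
Proof.
by case: A => V /= + eqV; rewrite eqV dim_vline eqb1.
Qed.

(** A point has dimension 1, which forces k to be nonzero. *)
Lemma point_vline_scale (R : realType) (A : point R) k a :
  A = <[k *: a]>%VS :> {vspace _} -> A = <[a]>%VS :> {vspace _}.
Proof.
move=> eA; rewrite eA vline_scale //.
by have := point_vline_neq0 eA; rewrite scaler_eq0 negb_or => /andP[].
Qed.

Lemma on_conic_bform (R : realType) (C : conic R) (A : point R) a :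
  A = <[a]>%VS :> {vspace _} -> on_conic C A -> bform (gram C) a a = 0.
Proof. by move=> eA; apply; rewrite eA memv_line. Qed.

Lemma on_conic_bform_neq0 (R : realType) (C : conic R) (A B : point R) a b :
  nondegenerate_conic C -> on_conic C A -> on_conic C B -> A != B ->
  A = <[a]>%VS :> {vspace _} -> B = <[b]>%VS :> {vspace _} ->
  bform (gram C) a b != 0.
Proof.
move=> nd onA onB nAB eA eB.
apply: bform_isotropic_neq0 => //; first exact: gram_sym.
- exact: point_vline_neq0 eA.
- apply: neq_lineP; first exact: point_vline_neq0 eB.
  rewrite -eA -eB eq_sym; exact: nAB.
- exact: on_conic_bform eA onA.
- exact: on_conic_bform eB onB.
Qed.

(** * The inscribed quadrangle and its eight points *)

(** The nonzero coefficients of the relation between the four isotropic vectors are absorbed into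
    the representatives of A1, A2 and A3. *)
Lemma inscribed_quadrangle_frame (R : realType) (C : conic R)
    (A1 A2 A3 A4 : point R) :
  nondegenerate_conic C -> uniq [:: A1; A2; A3; A4] ->
  on_conic C A1 -> on_conic C A2 -> on_conic C A3 -> on_conic C A4 ->
  exists a1 a2 a3, [/\ A1 = <[a1]>%VS :> {vspace _},
    A2 = <[a2]>%VS :> {vspace _}, A3 = <[a3]>%VS :> {vspace _} &
    A4 = <[a1 - a2 + a3]>%VS :> {vspace _}].
Proof.
move=> nd; rewrite /= !inE !negb_or.
move=> /and4P[/and3P[n12 n13 n14] /andP[n23 n24] n34 _] on1 on2 on3 on4.
have iso A (onA : on_conic C A) := on_conic_bform (point_coords A).2 onA.
have neq0 A B (onA : on_conic C A) onB nAB :=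
  @on_conic_bform_neq0 R C A B _ _ nd onA onB nAB
    (point_coords A).2 (point_coords B).2.
have nz2 : 2 != 0 :> R[i] by rewrite pnatr_eq0.
have [c1 [c2 [c3 [c1n0 c2n0 c3n0 eq4]]]] :=
  isotropic_quadruple_relation (gram_sym C) nz2 (iso _ on1) (iso _ on2)
    (iso _ on3) (iso _ on4) (neq0 _ _ on1 on2 n12) (neq0 _ _ on1 on3 n13)
    (neq0 _ _ on2 on3 n23) (neq0 _ _ on1 on4 n14) (neq0 _ _ on2 on4 n24)
    (neq0 _ _ on3 on4 n34).
exists (c1 *: coords A1), (c2 *: coords A2), (c3 *: coords A3).
rewrite -eq4 !vline_scale //.
by split; apply: (point_coords _).2.
Qed.

(** The line MU lies in the tangent at U, so m is orthogonal to the isotropic vector of U. *)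
Lemma bform_touch (R : realType) (C : conic R) (M U : point R) m z :
  M = <[m]>%VS :> {vspace _} -> touches_from C M U ->
  z \in line_through M U ->
  bform (gram C) z z * bform (gram C) m m = bform (gram C) z m ^+ 2.
Proof.
move=> eM [onU tU] zin; have [_ eU] := point_coords U.
have [s [t ->]] := mem_line_through eM eU zin.
apply: bform_tangent_line; first exact: gram_sym.
- exact: on_conic_bform eU onU.
- by apply: mem_tangent_bform eU _; apply: subvP tU _ _; rewrite eM memv_line.
Qed.

Theorem theorem4p3 (R : realType) (C : conic R)
  (A1 A2 A3 A4 M1 M2 N1 N2 P1 P2 U1 U2 V1 V2 Z1 Z2 Z3 Z4 : point R) :
  nondegenerate_conic C ->
  uniq [:: A1; A2; A3; A4] ->
  on_conic C A1 -> on_conic C A2 -> on_conic C A3 -> on_conic C A4 ->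
  meet_at (line_through A1 A2) (line_through A3 A4) M1 ->
  meet_at (line_through A2 A3) (line_through A4 A1) M2 ->
  meet_at (tangent C A1) (tangent C A2) N1 ->
  meet_at (tangent C A3) (tangent C A4) P1 ->
  meet_at (tangent C A1) (tangent C A4) N2 ->
  meet_at (tangent C A2) (tangent C A3) P2 ->
  U1 <> U2 -> touches_from C M1 U1 -> touches_from C M1 U2 ->
  V1 <> V2 -> touches_from C M2 V1 -> touches_from C M2 V2 ->
  meet_at (line_through M1 U1) (line_through M2 V1) Z1 ->
  meet_at (line_through M1 U1) (line_through M2 V2) Z2 ->
  meet_at (line_through M1 U2) (line_through M2 V2) Z3 ->
  meet_at (line_through M1 U2) (line_through M2 V1) Z4 ->
  exists D : conic R,
    (on_conic D N1 /\ on_conic D N2 /\ on_conic D P1 /\ on_conic D P2) /\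
    (on_conic D Z1 /\ on_conic D Z2 /\ on_conic D Z3 /\ on_conic D Z4).
Proof.
move=> nd uA on1 on2 on3 on4 meetM1 meetM2 meetN1 meetP1 meetN2 meetP2.
move=> _ touchU1 touchU2 _ touchV1 touchV2 meetZ1 meetZ2 meetZ3 meetZ4.
have [a1 [a2 [a3 [eA1 eA2 eA3 eA4]]]] :=
  inscribed_quadrangle_frame nd uA on1 on2 on3 on4.
have nz2 : 2 != 0 :> R[i] by rewrite pnatr_eq0.
have symS := gram_sym C.
have e11 := on_conic_bform eA1 on1; have e22 := on_conic_bform eA2 on2.
have e33 := on_conic_bform eA3 on3; have e44 := on_conic_bform eA4 on4.
move: uA; rewrite /= !inE !negb_or.
move=> /and4P[/and3P[n12 n13 _] /andP[n23 _] _ _].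
have {}n12 := on_conic_bform_neq0 nd on1 on2 n12 eA1 eA2.
have {}n13 := on_conic_bform_neq0 nd on1 on3 n13 eA1 eA3.
have {}n23 := on_conic_bform_neq0 nd on2 on3 n23 eA2 eA3.
have free_a := isotropic_triple_free symS nz2 e11 e22 e33 n12 n13 n23.
have eM1 : M1 = <[a1 - a2]>%VS :> {vspace _}.
  have [_ eM] := point_coords M1.
  have := memv_pick M1; rewrite -/(coords M1).
  move=> /(meet_atW meetM1)[/(mem_line_through eA1 eA2)[s [t E1]]].
  move=> /(mem_line_through eA3 eA4)[s' [t' E2]].
  (* These are the coordinates, in the frame a1, a2, a3, of the difference between the expressions
     of M1 on the lines A1A2 and A3A4. *)
  have [] := free_a (s - t') (t + t') (- s' - t').
    transitivity (coords M1 - coords M1); last by rewrite subrr.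
    by rewrite {1}E1 E2; apply/rowP => j; rewrite !mxE; ring.
  move=> /subr0_eq st /eqP; rewrite addr_eq0 => /eqP tt' _.
  by apply: (@point_vline_scale _ _ t'); rewrite eM E1 st tt' scaleNr scalerBr.
have eM2 : M2 = <[a2 - a3]>%VS :> {vspace _}.
  have [_ eM] := point_coords M2.
  have := memv_pick M2; rewrite -/(coords M2).
  move=> /(meet_atW meetM2)[/(mem_line_through eA2 eA3)[s [t E1]]].
  move=> /(mem_line_through eA4 eA1)[s' [t' E2]].
  have [] := free_a (- s' - t') (s + s') (t - s').
    transitivity (coords M2 - coords M2); last by rewrite subrr.
    by rewrite {1}E1 E2; apply/rowP => j; rewrite !mxE; ring.
  move=> _ /eqP; rewrite addr_eq0 => /eqP ss' /subr0_eq ts'.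
  apply: (@point_vline_scale _ _ (- s')).
  by rewrite eM E1 ss' ts' scalerBr !scaleNr opprK.
have nzD := diag_form_neq0 symS nz2 e11 e22 e33 e44 n13.
exists (Conic (diag_form_sym a1 a2 a3 symS) nzD).
have onD (P : point R) : (forall z, z \in (P : {vspace _}) ->
    bform (gram C) z (a1 + a3) ^+ 2 - bform (gram C) z (a1 - a2) ^+ 2
      - bform (gram C) z (a2 - a3) ^+ 2 = 0) ->
    on_conic (Conic (diag_form_sym a1 a2 a3 symS) nzD) P.
  by move=> zP z /zP; rewrite -bform_diag_form.
have onZ (U V Z : point R) : touches_from C M1 U -> touches_from C M2 V ->
    meet_at (line_through M1 U) (line_through M2 V) Z ->
    on_conic (Conic (diag_form_sym a1 a2 a3 symS) nzD) Z.
  move=> tU tV meetZ z /(meet_atW meetZ)[zU zV].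
  exact: (diag_form_tangent_meet symS nz2 e11 e22 e33 e44 n12 n13 n23
            (bform_touch eM1 tU zU) (bform_touch eM2 tV zV)).
split; last first.
  split; first exact: onZ touchU1 touchV1 meetZ1.
  split; first exact: onZ touchU1 touchV2 meetZ2.
  by split; [exact: onZ touchU2 touchV2 meetZ3 | exact: onZ touchU2 touchV1 meetZ4].
(* N1 and P1 satisfy b(z,e3) = 0 and N2 and P2 satisfy b(z,e2) = 0; in each case the remaining one
   of these two values is b(z,e1) up to sign. *)
split; [|split; [|split]]; apply: onD => z.
- move=> /(meet_atW meetN1)[/(mem_tangent_bform eA1) b1 /(mem_tangent_bform eA2) b2].
  by rewrite !bformE b1 b2; ring.
- move=> /(meet_atW meetN2)[/(mem_tangent_bform eA1) b1 /(mem_tangent_bform eA4)].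
  rewrite !bformE b1 add0r => /eqP; rewrite addrC subr_eq0 => /eqP ->; ring.
- move=> /(meet_atW meetP1)[/(mem_tangent_bform eA3) b3 /(mem_tangent_bform eA4)].
  rewrite !bformE b3 addr0 => /subr0_eq ->; ring.
- move=> /(meet_atW meetP2)[/(mem_tangent_bform eA2) b2 /(mem_tangent_bform eA3) b3].
  by rewrite !bformE b2 b3; ring.
Qed.
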